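(* Let $k\geq 2$ be an integer and let $Q=T[H_1,\dots,H_t]$ be a digraph composition, where $T$ has vertices $u_1,\dots,u_t$ ($t\ge 2$). Then: (a) $Q$ has a $k$-king if and only if there is $i\in[t]$ such that $u_i$ is a $k$-king of $T$ and at least one of the following holds: (i) $H_i$ has a $k$-king; (ii) $|V(H_i)|\geq 2$ and $u_i$ belongs to a (directed) cycle of $T$ of length at most $k$. (b) All vertices of $Q$ are $k$-kings of $Q$ if and only if for each $i\in[t]$, $u_i$ is a $k$-king of $T$ and at least one of the following holds: (i) all vertices of $H_i$ are $k$-kings of $H_i$; (ii) $|V(H_i)|\geq 2$ and $u_i$ belongs to a (directed) cycle of $T$ of length at most $k$.
   Context: All digraphs are finite, without loops or parallel arcs; paths and cycles are directed. For a digraph $D$ and vertices $x,y$, $d_D(x,y)$ is the length of a shortest directed $x$–$y$ path (infinite if none exists). Let $T$ be a digraph with vertices $u_1,\dots,u_t$ ($t\ge 2$) and let $H_1,\dots,H_t$ be digraphs, $H_i$ having vertices $u_{i,j}$, $1\le j\le n_i$. The composition $Q=T[H_1,\dots,H_t]$ is the digraph with vertex set $\{u_{i,j}: 1\le i\le t,1\le j\le n_i\}$ and arc set $\bigcup_{i=1}^t A(H_i)\cup\{u_{i,j}u_{p,q}: u_iu_p\in A(T), 1\le j\le n_i, 1\le q\le n_p\}$. For an integer $k\ge 2$, a $k$-king of a digraph $D$ is a vertex from which every other vertex of $D$ can be reached by a directed path of length at most $k$. *)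

(* Defs.v *)
From HB Require Import structures.
From mathcomp Require Import all_boot.
Set Implicit Arguments.
Unset Strict Implicit.
Unset Printing Implicit Defensive.

(* Opposite arcs x -> y and y -> x may both be present. *)
Record digraph := Digraph {
  vertex :> finType;
  arc : rel vertex;
  arc_irr : irreflexive arc
}.

Section Digraph.
Variable D : digraph.

(* The path has vertex sequence x :: p, hence length size p. *)
Definition dipath (x : D) (p : seq D) (y : D) : bool :=
  [&& path (@arc D) x p, uniq (x :: p) & last x p == y].

(* The cycle has length size c. Since there are no loops, a nonempty dicycle
   has length at least 2. *)
Definition dicycle (c : seq D) : bool :=
  [&& c != [::], cycle (@arc D) c & uniq c].

Definition king (k : nat) (x : D) : Prop :=
  forall y : D, y != x -> exists2 p : seq D, dipath x p y & size p <= k.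

Definition in_short_cycle (k : nat) (x : D) : Prop :=
  exists c : seq D, [/\ dicycle c, x \in c & size c <= k].

End Digraph.

Section Composition.
Variables (T : digraph) (H : T -> digraph).

Definition comp_vertex : finType := {i : T & H i}.

(* When tag x = tag y, tagged_as x y is the H (tag x)-component of y. *)
Definition comp_arc : rel comp_vertex := fun x y =>
  (tag x == tag y) && arc (tagged x) (tagged_as x y)
  || arc (tag x) (tag y).

Lemma comp_arc_irr : irreflexive comp_arc.
Proof. by case=> i v; rewrite /comp_arc tagged_asE !arc_irr andbF. Qed.

Definition composition : digraph := Digraph comp_arc_irr.

End Composition.

(* Main.v *)
Require Import Defs.
From HB Require Import structures.
From mathcomp Require Import all_boot.
(* Restores [arc], shadowed by the homonym of mathcomp [path]. *)
Import Defs.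
Set Implicit Arguments.
Unset Strict Implicit.
Unset Printing Implicit Defensive.

(** Replacing paths and cycles by walks of positive length, [x] is a [k]-king
    iff it reaches every other vertex within [k] steps, and [x] lies on a short
    cycle iff it reaches itself.  A walk of the composition either stays in one
    copy [H i] or projects to a walk of positive length in [T], and every walk
    of positive length in [T] lifts with arbitrary prescribed ends.  Hence
    [u_{i,j}] is a [k]-king of the composition iff [u_i] is a [k]-king of [T]
    and [u_{i,j}] reaches the rest of [H i] either inside [H i] or around a
    short cycle of [T] through [u_i]; this gives both parts. *)

(** Vertices may repeat, so walks project and lift freely; positive length keeps [reaches k x x]
    from being trivial. *)
Definition reaches (D : digraph) (k : nat) (x y : D) : Prop :=
  exists p : seq D, [/\ path (@arc D) x p, last x p = y & 0 < size p <= k].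

Lemma king_reaches (D : digraph) (k : nat) (x : D) :
  king k x <-> forall y, y != x -> reaches k x y.
Proof.
split=> kx y nyx.
  have [p /and3P[xp _ /eqP py] pk] := kx y nyx.
  exists p; split=> //; rewrite pk andbT lt0n size_eq0.
  by apply: contraNneq nyx => p0; rewrite -py p0.
have [p [xp py /andP[_ pk]]] := kx y nyx.
move: py; case/shortenP: xp => q xq uq sub_qp qy.
exists q; first by rewrite /dipath xq uq qy eqxx.
by apply: leq_trans pk; apply: uniq_leq_size sub_qp; case/andP: uq.
Qed.

Lemma in_short_cycle_reaches (D : digraph) (k : nat) (x : D) :
  in_short_cycle k x <-> reaches k x x.
Proof.
split=> [[c [/and3P[_ cyc _] xc ck]]|[[|y p] [xp px pk]]] //.
  have [i c' def_c'] := rot_to xc.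
  exists (rcons c' x); split; last 1 first.
  - by rewrite size_rcons -(size_rot i) def_c' in ck *.
  - by move: cyc; rewrite -(rot_cycle i) def_c'.
  - by rewrite last_rcons.
move: xp px pk => /= /andP[xy yp].
(* Only the part after the first arc [x -> y] is shortened; that arc then closes the resulting path
   from [y] to [x] into a cycle. *)
case/shortenP: yp => q yq uq sub_qp qx pk.
exists (y :: q); split.
- by rewrite /dicycle /= rcons_path yq qx xy.
- by rewrite -qx mem_last.
- apply: leq_ltn_trans pk; apply: uniq_leq_size sub_qp.
  by case/andP: uq.
Qed.

(** Finiteness replaces excluded middle: scan the enumeration of [I] and stop at the first index
    that yields [B]. *)
Lemma forall_or_distr_fin (I : finType) (A : I -> Prop) (B : Prop) :
  (forall i, A i \/ B) -> (forall i, A i) \/ B.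
Proof.
move=> AB.
suff [Aall|] : (forall i, i \in enum I -> A i) \/ B; [|by right|].
  by left=> i; apply: Aall; rewrite mem_enum.
elim: (enum I) => [|i s [As|]]; [by left| |by right].
by have [Ai|] := AB i; [left=> j /predU1P[->|/As] | right].
Qed.

Section Composition.
Variables (T : digraph) (H : T -> digraph).
Implicit Types x y : composition H.

(** Inner vertices of the walk lift to arbitrary vertices of the nonempty copies, and the last one
    to [y], even when [x] and [y] share a copy. *)
Lemma lift_path (hH : forall i : T, 1 <= #|H i|) (p : seq T) x y :
  path (@arc T) (tag x) p -> last (tag x) p = tag y -> 0 < size p ->
  exists q : seq (composition H),
    [/\ path (@arc _) x q, last x q = y & size q = size p].
Proof.
elim: p x => [|i [|j p] IHp] x //= /andP[xi ip] py _.
  by exists [:: y]; split=> //=; rewrite andbT /comp_arc -py xi orbT.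
have /card_gt0P[w _] := hH i.
have [q [wq qy sq]] := IHp (Tagged H w) ip py isT.
exists (Tagged H w :: q); split=> //=; last by rewrite sq.
by rewrite wq andbT /comp_arc xi orbT.
Qed.

(** Arcs inside a copy collapse under projection, so the walk in [T] may be shorter than [q]. *)
Lemma split_path x (q : seq (composition H)) :
  path (@arc _) x q ->
  (exists p : seq (H (tag x)), [/\ path (@arc _) (tagged x) p,
     last x q = Tagged H (last (tagged x) p) & size p = size q]) \/
  reaches (size q) (tag x) (tag (last x q)).
Proof.
elim: q x => [|y q IHq] x /=.
  by move=> _; left; exists [::]; case: x.
case/andP=> xy /IHq{IHq}; case/orP: xy => [/andP[/eqP] | xy].
  case: x y => i v [j w] /= eij; case: j / eij w => w.
  rewrite tagged_asE => vw [[p [wp -> sp]]|[p [ip pl /andP[p0 pq]]]].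
    by left; exists (w :: p); rewrite /= vw wp sp.
  by right; exists p; rewrite p0 leqW.
(* The first arc changes copy; if the rest stays in the copy of [y], that arc alone is the
   projection. *)
case=> [[p [_ -> _]]|[p [yp <- /andP[_ pq]]]]; right.
  by exists [:: tag y]; rewrite /= xy.
by exists (tag y :: p); rewrite /= xy.
Qed.

Lemma reaches_composition (hH : forall i : T, 1 <= #|H i|) (k : nat) x y :
  reaches k x y <->
  reaches k (tag x) (tag y) \/
  exists2 w : H (tag x), y = Tagged H w & reaches k (tagged x) w.
Proof.
split=> [[q [xq <- /andP[q0 qk]]]|[[p [xp py pk]]|]].
- have [[p [vp -> sp]]|[p [ip pl /andP[p0 pq]]]] := split_path xq.
    by right; exists (last (tagged x) p) => //; exists p; rewrite sp q0.
  by left; exists p; rewrite p0 (leq_trans pq qk).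
- have [q [xq qy sq]] := lift_path hH xp py (proj1 (andP pk)).
  by exists q; rewrite sq.
case: x => i v /= [w ->] [p [vp <- pk]].
exists (map (Tagged H) p); rewrite size_map last_map; split=> //.
rewrite path_map; apply: sub_path vp => a b ab.
by rewrite /= /comp_arc eqxx tagged_asE ab.
Qed.

Lemma king_composition (hH : forall i : T, 1 <= #|H i|) (k : nat) x :
  king k x <->
  king k (tag x) /\
  (king k (tagged x) \/ 2 <= #|H (tag x)| /\ in_short_cycle k (tag x)).
Proof.
case: x => i v /=; split=> [/king_reaches kx | [/king_reaches ki kv]].
  split.
    apply/king_reaches=> j nji; have /card_gt0P[w _] := hH j.
    have /(kx (Tagged H w)) : Tagged H w != Tagged H v.
      by apply: contraNneq nji => /(congr1 tag) /= ->.
    case/(reaches_composition hH)=> // -[u /(congr1 tag) /= ji].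
    by rewrite ji eqxx in nji.
  suff [kv|] : (forall w, w != v -> reaches k v w) \/
               2 <= #|H i| /\ in_short_cycle k i; [|by right|].
    by left; apply/king_reaches.
  apply: forall_or_distr_fin => w; have [-> | nwv] := eqVneq w v; first by left.
  have /kx/(reaches_composition hH) : Tagged H w != Tagged H v.
    by rewrite eq_Tagged.
  case=> /= [/in_short_cycle_reaches ci | [u /eqP]]; last first.
    by rewrite eq_Tagged /= => /eqP->; left.
  (* The distinct vertices [w] and [v] themselves show that [H i] has at least two vertices. *)
  right; split=> //; apply/card_gt1P.
  by exists w, v.
apply/king_reaches=> -[j w] nwv; apply/(reaches_composition hH) => /=.
have [eij | nji] := eqVneq j i; last by left; apply: ki.
case: i / eij v {ki} kv nwv => v [/king_reaches kv | [_ cj]].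
  by rewrite eq_Tagged /= => /kv ?; right; exists w.
by left; apply/in_short_cycle_reaches.
Qed.

End Composition.

Theorem theorem2p4 (k : nat) (T : digraph) (H : T -> digraph)
    (hk : 2 <= k) (hT : 2 <= #|T|) (hH : forall i : T, 1 <= #|H i|) :
  ((exists x : composition H, king k x) <->
   (exists i : T, king k i /\
      ((exists v : H i, king k v) \/ (2 <= #|H i| /\ in_short_cycle k i))))
  /\
  ((forall x : composition H, king k x) <->
   (forall i : T, king k i /\
      ((forall v : H i, king k v) \/ (2 <= #|H i| /\ in_short_cycle k i)))).
Proof.
have kingE := king_composition hH k.
split; split.
- case=> x /kingE[ki kv]; exists (tag x); split=> //.
  by case: kv => [kv | ]; [left; exists (tagged x) | right].
- case=> i [ki [[v kv] | ci]].
    by exists (Tagged H v); apply/kingE; split=> //; left.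
  have /card_gt0P[v _] := hH i.
  by exists (Tagged H v); apply/kingE; split=> //; right.
- move=> kQ i; split.
    have /card_gt0P[v _] := hH i.
    by have /kingE[] := kQ (Tagged H v).
  (* The alternative obtained may vary with [v], whereas the short cycle does not depend on [v]. *)
  by apply: forall_or_distr_fin => v; have /kingE[] := kQ (Tagged H v).
- move=> kTH x; apply/kingE; have [ki kv] := kTH (tag x); split=> //.
  by case: kv => [kv | ]; [left | right].
Qed.
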